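(* Let $M\subseteq\mathbb{T}$ satisfy the standing hypothesis. Then the complete core of $\rho^\forall_M$ for negation is the constant closure $\lambda X.\varnothing$; more precisely, $\lambda X.\varnothing$ is the only upper closure operator $\eta$ on $\langle\wp(\mathbb{T}),\supseteq\rangle$ with $\rho^\forall_M\sqsubseteq\eta$ and $\eta(\neg X)=\eta(\neg\,\eta(X))$ for all $X\subseteq\mathbb{T}$.
   Context: $\mathbb{T}$ is the set of traces $\langle i,\sigma\rangle$, $i\in\mathbb{Z}$, $\sigma:\mathbb{Z}\to\mathbb{S}$ for a set of states $\mathbb{S}$; $\neg X=\mathbb{T}\setminus X$; $X_{\downarrow s}=\{\langle i,\sigma\rangle\in X\mid\sigma_i=s\}$; $\oplus(X)=\{\langle i,\sigma\rangle\mid\langle i+1,\sigma\rangle\in X\}$, $\ominus(X)=\{\langle i,\sigma\rangle\mid\langle i-1,\sigma\rangle\in X\}$, $\curvearrowleft(X)=\{\langle -i,\lambda k.\sigma_{-k}\rangle\mid\langle i,\sigma\rangle\in X\}$. Standing hypothesis on $M$: (i) $|M_{\downarrow s}|>1$ for all $s\in\mathbb{S}$; (ii) $\oplus(M)=M=\ominus(M)$ and $\oplus(\curvearrowleft M)=\curvearrowleft M=\ominus(\curvearrowleft M)$. Universal closure: $\rho^\forall_M(X)=\{\langle i,\sigma\rangle\in M\mid M_{\downarrow\sigma_i}\subseteq X\}$. An upper closure operator on $\langle\wp(\mathbb{T}),\supseteq\rangle$ is a map monotone w.r.t. $\subseteq$, idempotent, with $\rho(X)\subseteq X$; $\rho\sqsubseteq\eta$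 iff $\rho(X)\supseteq\eta(X)$ for all $X$. The complete core of $\rho$ for a function $f$ is the $\sqsubseteq$-least closure $\eta$ with $\rho\sqsubseteq\eta$ that is complete for $f$, i.e. $\eta\circ f=\eta\circ f\circ\eta$. *)

(* Defs.v *)
From mathcomp Require Import all_boot all_order all_algebra.
From mathcomp Require Import boolp classical_sets functions cardinality.

Set Implicit Arguments.
Unset Strict Implicit.
Unset Printing Implicit Defensive.

Import GRing.Theory.
Local Open Scope classical_set_scope.
Local Open Scope ring_scope.

Definition trace (S : Type) : Type := (int * (int -> S))%type.

Section Traces.
Variable S : Type.
Implicit Types (M X : set (trace S)) (t : trace S) (s : S).

Definition present t : S := t.2 t.1.

Definition down X s : set (trace S) := [set t : trace S | X t /\ present t = s].

Definition oplus X : set (trace S) := [set t : trace S | X (t.1 + 1, t.2)].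

Definition ominus X : set (trace S) := [set t : trace S | X (t.1 - 1, t.2)].

Definition reversal X : set (trace S) :=
  [set ((- t.1, fun k : int => t.2 (- k)) : trace S) | t in X].

Definition standing M : Prop :=
  [/\ (* |M_s| > 1, i.e. not |M_s| <= 1 *)
      forall s, ~~ (down M s #<= `I_1)%card,
      oplus M = M /\ M = ominus M
    & oplus (reversal M) = reversal M /\ reversal M = ominus (reversal M)].

Definition rho_forall M X : set (trace S) :=
  [set t : trace S | M t /\ down M (present t) `<=` X].

End Traces.

Section Closures.
Variable T : Type.
Implicit Types (rho eta f : set T -> set T) (X Y : set T).

(* Closures are taken on the powerset ordered by reverse inclusion, so they
   are reductive (not extensive) for inclusion. *)
Definition uco eta : Prop :=
  [/\ forall X Y, X `<=` Y -> eta X `<=` eta Y,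
      forall X, eta (eta X) = eta X
    & forall X, eta X `<=` X].

Definition le_uco rho eta : Prop := forall X, eta X `<=` rho X.

Definition complete_for f eta : Prop :=
  forall X, eta (f X) = eta (f (eta X)).

Definition is_complete_core f rho eta : Prop :=
  [/\ uco eta, le_uco rho eta, complete_for f eta
    & forall eta', uco eta' -> le_uco rho eta' -> complete_for f eta' ->
        le_uco eta eta'].

End Closures.

(* Main.v *)
Require Import Defs.
From mathcomp Require Import all_boot all_order all_algebra.
From mathcomp Require Import boolp classical_sets functions cardinality.

(** No fibre [down M s] fits inside a singleton, so [rho_forall M [set t]], and
    hence [eta [set t]], is empty. Completeness then gives
    [eta setT = eta (~` [set t]) `<=` ~` [set t]] for every trace [t]: so
    [eta setT] is empty, and by monotonicity [eta] is constantly empty. *)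

Local Open Scope classical_set_scope.

Lemma rho_forall_set1 (S : Type) (M : set (trace S)) (t : trace S) :
  (forall s, ~~ (Defs.down M s #<= `I_1)%card) -> rho_forall M [set t] = set0.
Proof.
move=> M_gt1; rewrite -subset0 => u [_ sub_t].
(* A trace [u] in the closure would put its whole fibre inside [[set t]], bounding the cardinality
   of that fibre by 1. *)
have /negP := M_gt1 (present u); apply.
apply: card_le_trans (subset_card_le sub_t) _.
by have /card_eqPle[] := @card_set1 _ t.
Qed.

Lemma complete_for_setC_eq0 (T : Type) (eta : set T -> set T) :
  uco eta -> complete_for (@setC T) eta ->
  (forall t, eta [set t] = set0) -> eta = (fun=> set0).
Proof.
move=> [eta_mono _ eta_red] etaC eta1.
suff etaT : eta setT = set0.
  by apply: funext => X; rewrite -subset0 -etaT; apply: eta_mono.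
rewrite -subset0 => t etaTt.
(* Completeness at [[set t]] turns this claim into [eta setT t], which is [etaTt]. *)
have : eta (~` [set t]) t by rewrite etaC eta1 setC0.
by move/eta_red; apply.
Qed.

Theorem theorem5 (S : Type) (M : set (trace S)) (hM : standing M) :
  is_complete_core (@setC (trace S)) (rho_forall M)
    (fun _ : set (trace S) => set0)
  /\ (forall eta : set (trace S) -> set (trace S),
        [/\ uco eta, le_uco (rho_forall M) eta
          & forall X : set (trace S), eta (~` X) = eta (~` (eta X))]
        <-> eta = (fun _ : set (trace S) => set0)).
Proof.
have [M_gt1 _ _] := hM.
(* Uniqueness serves twice: for leastness of the core, since every competitor is the constant
   itself, and for the forward half of the equivalence. *)
have core0 eta : uco eta -> le_uco (rho_forall M) eta ->
    complete_for (@setC (trace S)) eta -> eta = (fun=> set0).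
  move=> eta_uco le_eta etaC; apply: complete_for_setC_eq0 => // t.
  by rewrite -subset0 -(rho_forall_set1 _ _ t M_gt1); apply: le_eta.
have uco0 : uco (fun _ : set (trace S) => set0) by split=> // *; exact: sub0set.
have le0 : le_uco (rho_forall M) (fun=> set0) by move=> X; exact: sub0set.
split; first by split=> // eta eta_uco le_eta etaC X; rewrite (core0 eta).
by move=> eta; split=> [[]|->]; first exact: core0.
Qed.
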